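(* Let $(G,\pi)$ be a parity game, $\tau$ a strategy for Odd, $T$ an $(n,d/2)$-universal tree with $h=d/2$, $\mathcal{C}$ a cover of $\mathcal{T}$, and $\mu:V\to\bar L(T)$ a node labeling such that $G_\tau$ has no loose arcs with respect to $\mu$. Fix a base node $w\in B(G_\tau)$ and let $j=\pi(w)/2$. For $0\le k<|\mathcal{C}_j|$, let $c^k$ be arc costs on $D_w$ with $\underline{c}^k\le c^k\le\overline{c}^k$, let $i^k$ be the minimum $c^k$-cost of a cycle of $D_w$ containing $w$ (the $c^k$-cost of a cycle being the maximum cost of its arcs; self-loops count as cycles), and let $\xi^k$ be the label returned by $\mathrm{Raise}(\mu(w),i^k,j,k)$, with $\xi^k=\top$ if $i^k=\infty$. Then $$\mu^{\mathcal{G}^\uparrow_\tau}(w)\le\min_{0\le k<|\mathcal{C}_j|}\xi^k\le\widehat{\mu}(w).$$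
   Context: A parity game: finite directed graph $G=(V,E)$, every node with an outgoing arc, $V=V_0\sqcup V_1$, priorities $\pi:V\to\{1,\dots,d\}$, $d$ even, $n=|V|$. A strategy for Odd is $\tau:V_1\to V$ with $v\tau(v)\in E$; $G_\tau=(V,E_\tau)$ with $E_\tau=\{vw\in E:v\in V_0\}\cup\{v\tau(v):v\in V_1\}$. An Even strategy $\sigma:V_0\to V$ ($v\sigma(v)\in E$) gives $G_\sigma$ (all arcs out of $V_1$, only $v\sigma(v)$ out of $v\in V_0$). For a subgraph $H$: $\pi(H)$ max priority, $H$ even if $\pi(H)$ even, $\Pi(H)$ nodes of priority $\pi(H)$ ($v$ dominates $H$ if $v\in\Pi(H)$), $H_p$ induced subgraph on nodes of priority $\le p$, $N^+_H(v)$ out-neighbours. Ordered trees: prefix-closed sets of tuples over a linearly ordered set, viewed as rooted trees, ordered lexicographically; leaves of a height-$h$ tree are at depth $h$, written $\xi=(\xi_{2h-1},\dots,\xi_1)$; $\xi|_p$ deletes components with index $<p$; $L(T)$ leaves, $\bar L(T)=L(T)\cup\{\top\}$, $\top$ maximal, $\top|_p=\top$. $T\sqsubseteq T'$: injective edge-preserving order-preserving leaf-to-leaf map; $\equiv$ both ways; $\sqsubset$ strict. $(\ell,h)$-universal: height $h$, every height-$h$ tree with $\le\ell$ leaves at depth $h$ embeds. For a labeling $\nu$ into $\bar L(S)$: arc $vw$ non-violated if ($\pi(v)$ even and $\nu(v)|_{\pi(v)}\ge\nu(w)|_{\pi(v)}$) or ($\pi(v)$ odd and ($\nu(v)|_{\pi(v)}>\nu(w)|_{\pi(v)}$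 or $\nu(v)=\nu(w)=\top$)); violated otherwise; tight if $\nu(v)$ is the smallest element of $\bar L(S)$ making $vw$ non-violated when substituted for $\nu(v)$; loose if neither. $\nu$ feasible in subgraph $H$: some Even strategy $\sigma$, with $v\sigma(v)\in E(H)$ whenever $v\in V_0$ has an outgoing arc in $H$, makes all arcs of $H$ in $G_\sigma$ non-violated; finite if no value $\top$. $\mu^{\mathcal{G}^\uparrow_\tau}$ is the pointwise least labeling $\nu\ge\mu$ into $\bar L(T)$ feasible in $G_\tau$ (it exists). Base nodes $B(G_\tau)$: nodes in $\Pi(C)$ for some even cycle $C$ of $G_\tau$. Threshold: $\widehat{\mu}(w):=\min\{\tilde\mu(w):\tilde\mu:V\to\bar L(T),\tilde\mu(w)\ge\mu(w),\tilde\mu\text{ feasible in a cycle dominated by }w\text{ in }G_\tau\}$. Covers: $\mathcal{T}_j$ = pairwise non-equivalent subtrees of $T$ rooted at depth $h-j$; cover $\mathcal{C}=(\mathcal{C}_0,\dots,\mathcal{C}_h)$, $\mathcal{C}_j=(\mathcal{C}^0_j,\dots)$ chains of $(\mathcal{T}_j,\sqsubseteq)$ covering $\mathcal{T}_j$; chain $\mathcal{C}^k_j$: $T^k_{0,j}\sqsubset T^k_{1,j}\sqsubset\cdots$. Width: for a subgraph $H$ of $G_\tau$, $j=\lceil\pi(H)/2\rceil$, $\alpha^k(H)$ = least $i$ with a finite labeling $V(H)\to L(T^k_{i,j})$ feasible in $H$ ($\infty$ if none). $\mathrm{Raise}(\xi,i,j,k)$ ($\xi\in L(T)$) returns the smallest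 leaf $\xi'\ge\xi$ of $T$ that is the smallest leaf of the subtree of $T$ rooted at $\xi'|_{2j}$, that subtree being equivalent to $T^k_{i',j}$ for some $i'\ge i$; $\top$ if none. Auxiliary digraph: for $w\in B(G_\tau)$, $K_w$ is the strongly connected component of $w$ in $(G_\tau)_{\pi(w)}$; $K'_w$ is $K_w$ minus all incoming arcs of nodes in $\Pi(K_w)\setminus\{w\}$; $J_w$ is the subgraph of $K'_w$ induced by nodes that can reach $w$ in $K'_w$. $D$ has node set $B(G_\tau)$, an arc $vw$ for distinct base nodes with $v\in\Pi(J_w)$, and a self-loop $ww$ whenever $w$ has an outgoing arc in $J_w$; $D_w$ is the (strongly connected) component of $D$ containing $w$. For $0\le i<|\mathcal{C}^k_j|$, $\lambda^k_{i,w}$ is the pointwise greatest labeling $\lambda:V(J_w)\to\bar L(T^k_{i,j})$ with $\lambda(w)=\min L(T^k_{i,j})$ such that no arc of $J_w$ is loose w.r.t. $\lambda$. For arcs $vw$ of $D$: $\underline{c}^k(vw):=\min\{i:\lambda^k_{i,w}(u)\ne\top\text{ for some }u\in N^+_{J_w}(v)\}$, $\overline{c}^k(vw):=\min\{\alpha^k(P):P\text{ a }u\text{-}w\text{ path in }J_w,\ u\in N^+_{J_w}(v)\}$, $\min\emptyset=\infty$. *)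

(* Defs.v *)
From HB Require Import structures.
From mathcomp Require Import all_boot all_order.
From mathcomp Require Import finmap.
From mathcomp Require Import boolp classical_sets.

Set Implicit Arguments.
Unset Strict Implicit.
Unset Printing Implicit Defensive.

Import Order.TTheory.
Local Open Scope order_scope.

Definition withtop (T : Type) := option T.
Definition tfin (T : Type) (x : T) : withtop T := Some x.

HB.instance Definition _ (T : choiceType) := Choice.on (withtop T).

Section WithTop.
Context {disp : Order.disp_t} {T : orderType disp}.
Implicit Types x y : withtop T.

Definition wt_le x y : bool :=
  match x, y with
  | _, None => true
  | None, Some _ => false
  | Some a, Some b => a <= b
  end.
Definition wt_lt x y := (y != x) && wt_le x y.
Definition wt_min x y := if wt_lt x y then x else y.
Definition wt_max x y := if wt_lt x y then y else x.

Fact wt_anti : antisymmetric wt_le.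
Proof. by move=> [a|] [b|] //= /le_anti ->. Qed.
Fact wt_trans : transitive wt_le.
Proof. by move=> [a|] [b|] [c|] //=; apply: le_trans. Qed.
Fact wt_total : total wt_le.
Proof. by move=> [a|] [b|] //=; apply: le_total. Qed.

HB.instance Definition _ := Order.isOrder.Build disp (withtop T)
  (fun _ _ => erefl) (fun _ _ => erefl) (fun _ _ => erefl)
  wt_anti wt_trans wt_total.

Fact wt_lex1 (x : withtop T) : x <= (None : withtop T).
Proof. by case: x. Qed.
HB.instance Definition _ := Order.hasTop.Build disp (withtop T) wt_lex1.

(* Minimum of a set, with value \top on the empty set.  Every set to which it
   is applied below lies in a well-ordered set (the extended naturals, or the
   labels of a finite tree), so the minimum exists as soon as it is nonempty. *)
Definition tmin (P : withtop T -> Prop) : withtop T :=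
  xget \top (fun x => P x /\ forall y, P y -> x <= y).

End WithTop.

(* \top plays the role of infinity. *)
Definition enat := withtop nat.

Section Trees.
Context {disp : Order.disp_t} {M : orderType disp}.
Implicit Types T S : {fset seq M}.

Definition tree_edge (x y : seq M) : bool :=
  (size y == (size x).+1) && prefix x y.

Definition leaves T : {fset seq M} :=
  [fset x in T | ~~ has (tree_edge x) T]%fset.

Definition is_otree (h : nat) T : Prop :=
  [/\ [::] \in T,
      forall x y, prefix x y -> y \in T -> x \in T
    & forall x, x \in leaves T -> size x = h].

Definition subtree T (r : seq M) : {fset seq M} :=
  [fset drop (size r) x | x in T & prefix r x]%fset.

End Trees.

Definition lexle {disp} {M : orderType disp} (x y : seq M) : bool :=
  (x : seqlexi M) <= (y : seqlexi M).

Definition embeds {disp disp' : Order.disp_t} {M : orderType disp}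
    {M' : orderType disp'} (T : {fset seq M}) (T' : {fset seq M'}) : Prop :=
  exists f : seq M -> seq M',
    [/\ {in T, forall x, f x \in T'},
        {in T &, injective f},
        {in T &, forall x y, tree_edge x y -> tree_edge (f x) (f y)},
        {in T &, forall x y, lexle x y -> lexle (f x) (f y)}
      & {in leaves T, forall x, f x \in leaves T'}].

Definition universal {disp} {M : orderType disp} (l h : nat)
    (T : {fset seq M}) : Prop :=
  is_otree h T /\
  forall disp' (M' : orderType disp') (T' : {fset seq M'}),
    is_otree h T' -> (#|` leaves T'| <= l)%N -> embeds T' T.

Section Labels.
Context {disp : Order.disp_t} {M : orderType disp}.
Implicit Types T S : {fset seq M}.

Definition tequiv S S' : Prop := embeds S S' /\ embeds S' S.
Definition sembeds S S' : Prop := embeds S S' /\ ~ tequiv S S'.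

(* [reps j] is the set of pairwise non-equivalent subtrees rooted at depth
   h - j, given as a choice of one representative per equivalence class. *)
Definition is_reps (h : nat) T (reps : nat -> {fset {fset seq M}}) : Prop :=
  forall j, (j <= h)%N ->
  [/\ forall S, S \in reps j ->
        exists r, [/\ r \in T, size r = (h - j)%N & S = subtree T r],
      forall S S', S \in reps j -> S' \in reps j -> tequiv S S' -> S = S'
    & forall r, r \in T -> size r = (h - j)%N ->
        exists2 S, S \in reps j & tequiv (subtree T r) S].

(* [nth [::] (C j) k] is the k-th chain at level j, listed increasingly. *)
Definition is_cover (h : nat) (reps : nat -> {fset {fset seq M}})
    (C : nat -> seq (seq {fset seq M})) : Prop :=
  forall j, (j <= h)%N ->
  [/\ forall ch S, ch \in C j -> S \in ch -> S \in reps j,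
      forall ch i i', ch \in C j -> (i < i')%N -> (i' < size ch)%N ->
        sembeds (nth fset0 ch i) (nth fset0 ch i')
    & forall S, S \in reps j -> exists2 ch, ch \in C j & S \in ch].

Definition label : Type := withtop (seqlexi M).

Definition in_Lbar S (x : label) : Prop :=
  forall l, x = tfin l -> l \in leaves S.

(* A leaf of a tree of height h is indexed (xi_(2h-1), xi_(2h-3), .., xi_1);
   exactly h - floor(p/2) of these odd indices are at least p. *)
Definition trunc (h p : nat) (x : seq M) : seq M := take (h - p./2) x.

Definition ltrunc (h p : nat) (x : label) : label :=
  if x is Some l then tfin (trunc h p l : seqlexi M) else \top.

Definition min_leaf S : label :=
  tmin (fun x : label => exists2 l, l \in leaves S & x = tfin l).

(* Raise(xi, i, j, k) in a tree T of height h, where ch is the k-th chain of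
   level j; the value is \top when xi = \top. *)
Definition raise (h : nat) T (ch : seq {fset seq M}) (xi : label) (i j : nat) :
    label :=
  tmin (fun x : label => exists l : seq M,
    [/\ x = tfin l, l \in leaves T, xi <= x,
        {in leaves T, forall l',
           trunc h j.*2 l' = trunc h j.*2 l -> lexle l l'}
      & exists i', [/\ (i <= i')%N, (i' < size ch)%N
          & tequiv (subtree T (trunc h j.*2 l)) (nth fset0 ch i')]]).

End Labels.
Arguments label {disp} M.

Record digraph (V : finType) := Digraph {
  nodes : {set V};
  arcs : rel V
}.

Section Digraphs.
Context {V : finType}.
Implicit Types H : digraph V.

Definition induced H (A : {set V}) : digraph V :=
  Digraph (nodes H :&: A) [rel x y | [&& arcs H x y, x \in A & y \in A]].

Definition scc H (w : V) : digraph V :=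
  induced H [set v | connect (arcs H) v w && connect (arcs H) w v].

Definition remove_in H (A : {set V}) : digraph V :=
  Digraph (nodes H) [rel x y | arcs H x y && (y \notin A)].

Definition is_path H (u : V) (p : seq V) (w : V) : Prop :=
  [/\ u \in nodes H, path (arcs H) u p, uniq (u :: p) & last u p = w].

Definition path_graph (u : V) (p : seq V) : digraph V :=
  Digraph [set x in u :: p] [rel x y | (x, y) \in zip (u :: p) p].

Definition is_cycle H (s : seq V) : Prop := s != [::] /\ ucycle (arcs H) s.

Definition cycle_graph (s : seq V) : digraph V :=
  Digraph [set x in s] [rel x y | (x \in s) && (y == next s x)].

End Digraphs.

Record parity_game (V : finType) (d : nat) := ParityGame {
  garc : rel V;
  even_node : {set V};
  prio : V -> nat;
  garc_total : forall v, exists w, garc v w;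
  prio_bound : forall v, (1 <= prio v <= d)%N;
  d_even : ~~ odd d
}.

Section Game.
Context {V : finType} {d : nat} (G : parity_game V d).
Context {disp : Order.disp_t} {M : orderType disp}.
Implicit Types (H : digraph V) (nu mu : V -> label M).
Implicit Types (S T : {fset seq M}).

Notation V0 := (even_node G).
Notation pi := (prio G).

(* Only the values of a strategy on the nodes of its player are relevant. *)
Definition odd_strategy (tau : V -> V) : Prop :=
  forall v, v \notin V0 -> garc G v (tau v).
Definition even_strategy (sigma : V -> V) : Prop :=
  forall v, v \in V0 -> garc G v (sigma v).

Definition Gtau (tau : V -> V) : digraph V :=
  Digraph [set: V] [rel v w | garc G v w && ((v \in V0) || (w == tau v))].

Definition hprio H : nat := (\max_(v in nodes H) pi v)%N.
Definition dominators H : {set V} := [set v in nodes H | pi v == hprio H].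
Definition below H (p : nat) : digraph V := induced H [set v | (pi v <= p)%N].

(* Below, h is the height of the tree providing the labels. *)

Definition nonviolated (h : nat) nu (v w : V) : bool :=
  let t := ltrunc h (pi v) in
  if odd (pi v) then
    (t (nu w) < t (nu v)) || ((nu v == \top) && (nu w == \top))
  else t (nu w) <= t (nu v).

(* The substitution also affects the head of a self-loop. *)
Definition tight (h : nat) S nu (v w : V) : Prop :=
  nonviolated h nu v w /\
  forall x, in_Lbar S x -> nonviolated h [eta nu with v |-> x] v w -> nu v <= x.

Definition loose (h : nat) S nu (v w : V) : Prop :=
  nonviolated h nu v w /\ ~ tight h S nu v w.

Definition feasible (h : nat) H nu : Prop :=
  exists sigma : V -> V,
    [/\ even_strategy sigma,
        forall v, v \in V0 -> (exists w, arcs H v w) -> arcs H v (sigma v)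
      & forall v w, arcs H v w -> (v \in V0 -> w = sigma v) ->
          nonviolated h nu v w].

Definition lift_closure (h : nat) T (tau : V -> V) mu : V -> label M :=
  let ok nu := [/\ forall v, in_Lbar T (nu v), forall v, mu v <= nu v
                 & feasible h (Gtau tau) nu] in
  xget (fun=> \top)
    (fun nu => ok nu /\ forall nu', ok nu' -> forall v, nu v <= nu' v).

Definition base_nodes (tau : V -> V) : {set V} :=
  [set w | `[< exists s, [/\ is_cycle (Gtau tau) s,
                ~~ odd (hprio (cycle_graph s))
              & w \in dominators (cycle_graph s)] >]].

Definition threshold (h : nat) T (tau : V -> V) mu (w : V) : label M :=
  tmin (fun x => exists nu s,
    [/\ forall v, in_Lbar T (nu v), mu w <= nu w,
        is_cycle (Gtau tau) s, w \in dominators (cycle_graph s)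
      & feasible h (cycle_graph s) nu /\ x = nu w]).

Definition width (C : nat -> seq (seq {fset seq M})) (k : nat) H : enat :=
  let j := uphalf (hprio H) in
  let ch := nth [::] (C j) k in
  tmin (fun a : enat => exists i, [/\ (i < size ch)%N, a = tfin i &
    exists nu, feasible j H nu /\
      forall v, v \in nodes H ->
        exists2 l, l \in leaves (nth fset0 ch i) & nu v = tfin l]).

Definition Kgraph tau (w : V) : digraph V := scc (below (Gtau tau) (pi w)) w.

Definition Kgraph' tau (w : V) : digraph V :=
  remove_in (Kgraph tau w) (dominators (Kgraph tau w) :\ w).

Definition Jgraph tau (w : V) : digraph V :=
  induced (Kgraph' tau w) [set u | connect (arcs (Kgraph' tau w)) u w].

Definition Dgraph tau : digraph V :=
  Digraph (base_nodes tau) [rel v w |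
    [&& v \in base_nodes tau, w \in base_nodes tau &
      if v == w then [exists u, arcs (Jgraph tau w) w u]
      else v \in dominators (Jgraph tau w)]].

Definition Dcomp tau (w : V) : digraph V := scc (Dgraph tau) w.

(* Only the values on the nodes of J_w are relevant. *)
Definition lam tau (S : {fset seq M}) (w : V) : V -> label M :=
  let J := Jgraph tau w in
  let h := (pi w)./2 in
  let ok nu := [/\ forall v, v \in nodes J -> in_Lbar S (nu v),
                   nu w = min_leaf S
                 & forall v u, arcs J v u -> ~ loose h S nu v u] in
  xget (fun=> \top)
    (fun nu => ok nu /\
       forall nu', ok nu' -> forall v, v \in nodes J -> nu' v <= nu v).

Definition cost_lower (C : nat -> seq (seq {fset seq M})) tau (k : nat)
    (v w : V) : enat :=
  let ch := nth [::] (C (pi w)./2) k in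
  tmin (fun a : enat => exists i, [/\ (i < size ch)%N, a = tfin i &
    exists2 u, arcs (Jgraph tau w) v u &
      lam tau (nth fset0 ch i) w u <> \top]).

Definition cost_upper (C : nat -> seq (seq {fset seq M})) tau (k : nat)
    (v w : V) : enat :=
  tmin (fun a : enat => exists u p,
    [/\ arcs (Jgraph tau w) v u, is_path (Jgraph tau w) u p w
      & a = width C k (path_graph u p)]).

Definition cycle_cost (c : V -> V -> enat) (s : seq V) : enat :=
  \big[Order.max/tfin 0%N]_(v <- s) c v (next s v).

Definition min_cycle_cost (c : V -> V -> enat) H (w : V) : enat :=
  tmin (fun a => exists s, [/\ is_cycle H s, w \in s & a = cycle_cost c s]).

(* xi^k as a function of the arc costs c = c^k. *)
Definition raised_label (h : nat) T (C : nat -> seq (seq {fset seq M})) tau mu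
    (w : V) (k : nat) (c : V -> V -> enat) : label M :=
  let j := (pi w)./2 in
  if min_cycle_cost c (Dcomp tau w) w is Some i
  then raise h T (nth [::] (C j) k) (mu w) i j
  else \top.

End Game.

(* Main.v *)
(* Since no arc is loose, mu(v) is at most any label that makes an arc out of v
   non-violated against mu; so an upper bound on mu at a node propagates
   backwards along arcs.

   Upper bound on the lift: let l be the label returned by Raise, r its prefix,
   and w = w_0 -> w_1 -> .. -> w a cycle of D of cost at most i.  Writing
   arcs of this cycle as v -> t, the labeling lam of J_t, embedded below r,
   dominates mu on J_t and has a non-violated arc out of each node other than t.
   Giving label l to the nodes of the cycle and the embedded labels to the nodes
   of the J_t thus yields a feasible labeling above mu.

   Lower bound on the threshold: a finite feasible labeling nu of a cycle
   dominated by w with nu(w) >= mu(w) has values in the subtree at a single node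
   r, and mu(w) is at most the least leaf of that subtree.  The subtree is
   equivalent to some T^k_i, and the segments of the cycle between consecutive
   dominators are arcs of D of cost at most i. *)
Require Import Defs.
From mathcomp Require Import all_boot all_order.
From mathcomp Require Import finmap.
From mathcomp Require Import boolp classical_sets.

Set Implicit Arguments.
Unset Strict Implicit.
Unset Printing Implicit Defensive.

Import Order.TTheory.

(** * Minima of sets of labels and of extended naturals *)

Section TMin.
Local Open Scope order_scope.
Context {disp : Order.disp_t} {T : orderType disp}.
Implicit Types (P : withtop T -> Prop) (x y : withtop T).

Lemma tmin_attained P : tmin P <> \top -> P (tmin P).
Proof. by rewrite /tmin; case: xgetP => // x _ []. Qed.

Lemma tmin_tfin P (a : T) : tmin P = tfin a -> P (tfin a).
Proof. by move=> aE; rewrite -aE; apply: tmin_attained; rewrite aE. Qed.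

(* The hypothesis on [s] makes the part of [P] below [y] finite. *)
Lemma tmin_min P (s : seq (withtop T)) y :
  (forall x, P x -> x <= y -> x \in s) -> P y ->
  P (tmin P) /\ forall x, P x -> tmin P <= x.
Proof.
move=> Ps Py.
suff [x [Px xmin]] : exists x, P x /\ forall z, P z -> x <= z.
  rewrite /tmin; case: xgetP => [z _ //|/(_ x) noP]; by case: noP.
have [x0 [Px0 x0y x0min]] : exists x0, [/\ P x0, x0 <= y
    & forall z, z \in s -> P z -> x0 <= z].
  elim: {Ps} s => [|a s [x0 [Px0 x0y x0min]]]; first by exists y.
  case: (pselect (P a)) => [Pa|nPa].
    case: (leP x0 a) => [x0a|ax0].
      exists x0; split=> // z; rewrite inE => /orP[/eqP -> //|]; exact: x0min.
    exists a; split=> //; first exact: le_trans (ltW ax0) x0y.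
    move=> z; rewrite inE => /orP[/eqP -> //|zs Pz].
    exact: le_trans (ltW ax0) (x0min _ zs Pz).
  exists x0; split=> // z; rewrite inE => /orP[/eqP -> //|]; exact: x0min.
exists x0; split=> // z Pz.
case: (leP z y) => [zy|/ltW yz]; last exact: le_trans x0y yz.
exact: x0min (Ps _ Pz zy) Pz.
Qed.

Lemma top_le x : (\top <= x) = (x == \top).
Proof. by case: x. Qed.

Lemma le_tfin x (b : T) : x <= tfin b -> exists2 a, x = tfin a & a <= b.
Proof. by case: x => // a ab; exists a. Qed.

End TMin.

(** Finitely many naturals lie below a finite bound, as [tmin_min] requires; an infinite [y] is
    replaced by a finite element of [P] if there is one. *)
Lemma tmin_enat_min (P : enat -> Prop) y :
  P y -> P (tmin P) /\ forall x, P x -> (tmin P <= x)%O.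
Proof.
case: y => [n|] Py; last first.
  case: (pselect (exists n, P (Some n))) => [[n Pn]|noP].
    apply: (@tmin_min _ _ _ [seq Some i | i <- iota 0 n.+1] (Some n)) => //.
    move=> [i|] // Pi lein; apply: map_f; rewrite mem_iota add0n ltnS; exact: lein.
  apply: (@tmin_min _ _ _ [:: None] None) => // -[i|] // Pi; by case: noP; exists i.
apply: (@tmin_min _ _ _ [seq Some i | i <- iota 0 n.+1] (Some n)) => //.
move=> [i|] // Pi lein; apply: map_f; rewrite mem_iota add0n ltnS; exact: lein.
Qed.

(** * Lexicographic order, truncation and the non-violation condition *)

Section Lexi.
Local Open Scope order_scope.
Context {disp : Order.disp_t} {M : orderType disp}.
Implicit Types (x y r : seq M) (S T : {fset seq M}) (a b : label M).

Lemma lexle_cat r x y : lexle (r ++ x) (r ++ y) = lexle x y.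
Proof. by rewrite /lexle; elim: r => //= c r IH; rewrite lexi_cons lexx /= IH. Qed.

Lemma lexle_take m x y : lexle x y -> lexle (take m x) (take m y).
Proof.
rewrite /lexle; elim: m x y => [|m IH] [|c x] [|e y] //=; rewrite !lexi_cons.
case/andP => -> /= /implyP H; apply/implyP => /H; exact: IH.
Qed.

Lemma ltrunc_le h p a b : a <= b -> ltrunc h p a <= ltrunc h p b.
Proof. by case: a b => [a|] [b|] //; apply: lexle_take. Qed.

(* The condition on the labels [a] of the tail and [b] of the head, for an arc
   whose tail has priority [p], to be non-violated. *)
Definition nonviolating h p a b : bool :=
  if odd p then (ltrunc h p b < ltrunc h p a) || ((a == \top) && (b == \top))
  else ltrunc h p b <= ltrunc h p a.

Lemma nonviolating_top h p b : nonviolating h p \top b.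
Proof.
by rewrite /nonviolating; case: ifP => _; case: b.
Qed.

Lemma nonviolating_finite h p a b :
  nonviolating h p a b -> a != \top -> b != \top.
Proof.
by rewrite /nonviolating; case: ifP => _; case: a b => [a|] [b|].
Qed.

(** Truncation is monotone. If both labels are [\top], lowering the head to a finite label yields a
    strict inequality. *)
Lemma nonviolating_mono h p a a' b b' :
  a <= a' -> b' <= b -> nonviolating h p a b -> nonviolating h p a' b'.
Proof.
move=> aa' b'b; rewrite /nonviolating; case: ifP => _.
  case/orP => [ba|/andP[/eqP aT _]].
    by rewrite (le_lt_trans (ltrunc_le h p b'b) (lt_le_trans ba (ltrunc_le h p aa'))).
  move: aa'; rewrite aT top_le => /eqP ->.
  by case: b' {b'b} => //=.
by move=> ba; apply: le_trans (le_trans (ltrunc_le h p b'b) ba) (ltrunc_le h p aa').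
Qed.

Lemma nonviolating_refl h p a : ~~ odd p -> nonviolating h p a a.
Proof. by rewrite /nonviolating => /negbTE ->. Qed.

Lemma nonviolating_irrefl h p a : odd p -> nonviolating h p a a -> a = \top.
Proof. by rewrite /nonviolating => ->; rewrite ltxx /= andbb => /eqP. Qed.

(** Brings the arcs of a cycle to one common even priority: truncation at [q] factors through
    truncation at [p]. *)
Lemma nonviolating_trunc_le h p q a b : (p <= q)%N -> ~~ odd q ->
  nonviolating h p a b -> nonviolating h q a b.
Proof.
move=> pq q_even ab; have {ab} : ltrunc h p b <= ltrunc h p a.
  move: ab; rewrite /nonviolating; case: ifP => // _ /orP[/ltW //|].
  by case/andP => /eqP -> /eqP ->.
have trE (c : label M) : ltrunc h q c = ltrunc h q (ltrunc h p c).
  case: c => //= c; congr Some; rewrite /trunc take_takel //.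
  by rewrite leq_sub2l // half_leq.
rewrite /nonviolating (negbTE q_even) (trE a) (trE b); exact: ltrunc_le.
Qed.

End Lexi.

(** * Trees, embeddings, and the transport of labels into a subtree *)

Section TreeLemmas.
Local Open Scope order_scope.
Context {disp : Order.disp_t} {M : orderType disp}.
Implicit Types (x y z r : seq M) (S T : {fset seq M}) (a b : label M).

Lemma lexle_total x y : lexle x y || lexle y x.
Proof. exact: (@le_total _ (seqlexi M)). Qed.

Lemma lexle_anti x y : lexle x y -> lexle y x -> x = y.
Proof. by move=> xy yx; apply: (@le_anti _ (seqlexi M)); apply/andP. Qed.

Lemma nonviolating_tfin h p x y :
  nonviolating h p (tfin (x : seqlexi M)) (tfin (y : seqlexi M)) =
  if odd p then ~~ lexle (trunc h p x) (trunc h p y)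
  else lexle (trunc h p y) (trunc h p x).
Proof. by rewrite /nonviolating /= orbF ltNge. Qed.

Lemma mem_leaves T x : (x \in leaves T) = (x \in T) && ~~ has (tree_edge x) T.
Proof. by rewrite !inE /=. Qed.

Lemma leaf_mem T x : x \in leaves T -> x \in T.
Proof. by rewrite mem_leaves => /andP[]. Qed.

Lemma mem_subtree T r y : (y \in subtree T r) = (r ++ y \in T).
Proof.
apply/imfsetP/idP => /= [[x]|ryT].
  by rewrite inE /= => /andP[xT /prefixP[z zE]] ->; move: xT; rewrite zE drop_size_cat.
by exists (r ++ y); rewrite ?drop_size_cat // inE /= ryT prefix_prefix.
Qed.

Lemma tree_edge_cat r x y : tree_edge (r ++ x) (r ++ y) = tree_edge x y.
Proof.
by rewrite /tree_edge !size_cat -addnS eqn_add2l prefix_catr ?eqxx.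
Qed.

Lemma leaves_subtree T r y : (y \in leaves (subtree T r)) = (r ++ y \in leaves T).
Proof.
rewrite !mem_leaves mem_subtree; congr (_ && ~~ _).
apply/hasP/hasP => -[z zT yz].
  by exists (r ++ z); rewrite ?tree_edge_cat -?mem_subtree.
have zE : z = r ++ drop (size r) z.
  by move: yz => /andP[_ /prefixP[t ->]]; rewrite -catA drop_size_cat.
by exists (drop (size r) z); rewrite ?mem_subtree -?zE // -(tree_edge_cat r) -zE.
Qed.

Lemma subtree_otree h T r :
  is_otree h T -> r \in T -> is_otree (h - size r) (subtree T r).
Proof.
case=> _ Tpre Tlf rT; split; first by rewrite mem_subtree cats0.
  by move=> x y xy; rewrite !mem_subtree; apply: Tpre; rewrite prefix_catr ?eqxx.
by move=> x; rewrite leaves_subtree => /Tlf <-; rewrite size_cat addKn.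
Qed.

Lemma leaf_trunc_mem h T p x : is_otree h T -> x \in leaves T -> trunc h p x \in T.
Proof. by case=> _ Tpre _ xT; apply: Tpre (leaf_mem xT); apply: prefix_take. Qed.

Lemma size_leaf_trunc h T p x : is_otree h T -> x \in leaves T ->
  size (trunc h p x) = (h - p./2)%N.
Proof. by case=> _ _ Tlf /Tlf xh; rewrite size_take_min xh; apply/minn_idPl/leq_subr. Qed.

Lemma embeds_refl T : embeds T T.
Proof. by exists id; split. Qed.

Lemma embeds_trans S T (U : {fset seq M}) : embeds S T -> embeds T U -> embeds S U.
Proof.
case=> f [f1 f2 f3 f4 f5] [g [g1 g2 g3 g4 g5]]; exists (g \o f); split=> /=.
- by move=> x /f1/g1.
- by move=> x y xS yS /g2/f2-> //; apply: f1.
- by move=> x y xS yS /f3 -/(_ xS yS); apply: g3; apply: f1.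
- by move=> x y xS yS /f4 -/(_ xS yS); apply: g4; apply: f1.
- by move=> x /f5/g5.
Qed.

(* Since all leaves are at the same depth on both sides, an embedding preserves
   depths, hence commutes with truncation. *)
Lemma embeds_leaves j S S' :
  is_otree j S -> is_otree j S' -> embeds S S' ->
  exists f : seq M -> seq M,
    {in leaves S, forall y, f y \in leaves S'} /\
    {in leaves S &, forall y z m,
      lexle (take m (f y)) (take m (f z)) = lexle (take m y) (take m z)}.
Proof.
case=> _ Spre Slf [_ S'pre S'lf] [f [fS finj fedge fmon flf]]; exists f; split=> //.
have takeS m y : y \in leaves S -> take m y \in S.
  by move=> /leaf_mem; apply: Spre; apply: prefix_take.
have ftake m y : y \in leaves S -> f (take m y) = take m (f y).
  move=> yS; have yj := Slf _ yS; have fyj := S'lf _ (flf _ yS).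
  case: (leqP j m) => [jm|/ltnW mj]; first by rewrite !take_oversize ?yj ?fyj.
  (* Induction upwards from the leaf, whose image has known depth; each edge of [S] on the way
     removes exactly one component from the image. *)
  have step i : (i <= j)%N ->
      size (f (take (j - i) y)) + i = j /\ prefix (f (take (j - i) y)) (f y).
    elim: i => [|i IH] ij; first by rewrite subn0 take_oversize ?yj // addn0 fyj prefix_refl.
    have [szi prei] := IH (ltnW ij).
    have : tree_edge (take (j - i.+1) y) (take (j - i) y).
      have -> : (j - i = (j - i.+1).+1)%N by rewrite subnSK.
      rewrite /tree_edge !size_take_min yj.
      rewrite (minn_idPl _) ?(minn_idPl _) ?leq_subr ?subnSK ?leq_subr // eqxx /=.
      rewrite -[X in prefix X _](@take_takel _ _ (j - i)) ?leq_sub2l //.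
      exact: prefix_take.
    move/fedge => -/(_ (takeS _ _ yS) (takeS _ _ yS)) /andP[/eqP sz pre].
    split; last exact: prefix_trans pre prei.
    by rewrite addnS -addSn -sz.
  have [] := step _ (leq_subr m j); rewrite subKn // => sz.
  rewrite prefixE => /eqP <-; congr take.
  by apply/eqP; rewrite -(eqn_add2r (j - m)) sz subnKC.
move=> y z yS zS m; rewrite -!ftake //; apply/idP/idP; last by apply: fmon; apply: takeS.
(* If the prefix of [z] comes first, the two images are equal by antisymmetry, and injectivity makes
   the prefixes equal. *)
case/orP: (lexle_total (take m y) (take m z)) => // zy yz.
have /fmon -/(_ (takeS _ _ zS) (takeS _ _ yS)) fzy := zy.
by rewrite (finj _ _ (takeS _ _ yS) (takeS _ _ zS) (lexle_anti yz fzy)) /lexle lexx.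
Qed.

(** A priority of at most [j.*2] keeps at least [h - j] components, so the truncation never cuts
    into [r]. *)
Lemma trunc_cat h j p r y : size r = (h - j)%N -> (j <= h)%N -> (p <= j.*2)%N ->
  trunc h p (r ++ y) = r ++ trunc j p y.
Proof.
move=> rsz jh pj; have p2j : (p./2 <= j)%N by rewrite -[j]doubleK half_leq.
have hE : (h - p./2 = size r + (j - p./2))%N by rewrite rsz addnBA // subnK.
by rewrite /trunc hE take_cat ltnNge leq_addr /= addKn.
Qed.

Lemma trunc_cat_root h j r y : size r = (h - j)%N -> (j <= h)%N ->
  trunc h j.*2 (r ++ y) = r.
Proof. by move=> rsz jh; rewrite (@trunc_cat h j) // /trunc doubleK subnn take0 cats0. Qed.

Lemma trunc_drop h j l :
  (l : seq M) = trunc h j.*2 l ++ drop (h - j) l.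
Proof. by rewrite /trunc doubleK cat_take_drop. Qed.

(** Transports labels of a tree of height [j] to labels of [T]: [f] maps its leaves into the subtree
    at [r], whose leaves become leaves of [T] once [r] is prepended. *)
Definition graft r (f : seq M -> seq M) a : label M :=
  if a is Some y then tfin (r ++ f y : seqlexi M) else \top.

Section Graft.
Variables (h j : nat) (T S : {fset seq M}) (r : seq M) (f : seq M -> seq M).
Hypotheses (rsz : size r = (h - j)%N) (jh : (j <= h)%N).
Hypothesis (fleaf : {in leaves S, forall y, f y \in leaves (subtree T r)}).
Hypothesis (fle : {in leaves S &, forall y z m,
  lexle (take m (f y)) (take m (f z)) = lexle (take m y) (take m z)}).

Lemma graft_in_Lbar a : in_Lbar S a -> in_Lbar T (graft r f a).
Proof.
case: a => [y|] // yS l [<-].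
by rewrite -leaves_subtree; apply: fleaf; apply: yS.
Qed.

Lemma graft_nonviolating p a b : (p <= j.*2)%N -> in_Lbar S a -> in_Lbar S b ->
  nonviolating j p a b -> nonviolating h p (graft r f a) (graft r f b).
Proof.
case: a => [y|] pj yS; last by move=> _ _; apply: nonviolating_top.
case: b => [z|] zS; last by move/nonviolating_finite => /(_ isT) /eqP.
move: (yS _ erefl) (zS _ erefl) => {}yS {}zS.
rewrite !nonviolating_tfin !(@trunc_cat h j) //.
by rewrite !lexle_cat !fle.
Qed.

Lemma graft_le a b : in_Lbar S a -> in_Lbar S b -> a <= b ->
  graft r f a <= graft r f b.
Proof.
case: a b => [y|] [z|] // yS zS; move: (yS _ erefl) (zS _ erefl) => {}yS {}zS yz.
(* At this length none of the four sequences is truncated, so [fle] compares the whole leaves. *)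
have := fle yS zS (maxn (maxn (size (f y)) (size (f z))) (maxn (size y) (size z))).
rewrite !take_oversize ?leq_max ?leqnn ?orbT // => fyz.
change (lexle (r ++ f y) (r ++ f z)); rewrite lexle_cat fyz; exact: yz.
Qed.

Lemma graft_root a : in_Lbar S a -> a != \top ->
  exists l, [/\ graft r f a = tfin (l : seqlexi M), l \in leaves T
    & trunc h j.*2 l = r].
Proof.
case: a => // y yS _; exists (r ++ f y); split=> //; last exact: trunc_cat_root.
by rewrite -leaves_subtree; apply: fleaf; apply: yS.
Qed.

End Graft.

Lemma in_Lbar_tfin T l : l \in leaves T -> in_Lbar T (tfin (l : seqlexi M)).
Proof. by move=> lT _ [<-]. Qed.

Lemma tmin_label_min T (P : label M -> Prop) a :
  (forall b, P b -> in_Lbar T b) -> P a ->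
  P (tmin P) /\ forall b, P b -> tmin P <= b.
Proof.
move=> PT Pa.
pose s : seq (label M) := \top :: [seq tfin (l : seqlexi M) | l <- leaves T].
apply: (@tmin_min _ _ P s a) => //.
move=> [l|] Pb _; rewrite inE ?eqxx //; apply/orP; right; apply: map_f.
  exact: PT Pb _ erefl.
Qed.

End TreeLemmas.

(** * Loose arcs, and the least feasible labeling above [mu] *)

Section Labelings.
Local Open Scope order_scope.
Context {V : finType} {d : nat} (G : parity_game V d).
Context {disp : Order.disp_t} {M : orderType disp}.
Implicit Types (nu mu : V -> label M) (T S : {fset seq M}) (tau : V -> V).

Lemma nonviolatedE h nu v y :
  nonviolated G h nu v y = nonviolating h (prio G v) (nu v) (nu y).
Proof. by []. Qed.

Lemma not_looseP h S nu v y : ~ loose G h S nu v y <->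
  forall a, in_Lbar S a ->
    nonviolating h (prio G v) a ([eta nu with v |-> a] y) -> nu v <= a.
Proof.
split=> [nloose a aS ava | le_nu [nv_vy]]; last first.
  by apply; split=> // a /le_nu; rewrite nonviolatedE /= eqxx.
case: leP => // a_lt; have tight_vy : nonviolated G h nu v y -> tight G h S nu v y.
  by move=> nv_vy; case: (pselect (tight G h S nu v y)) => // ntight; case: nloose.
have nv_vy : nonviolated G h nu v y.
  rewrite nonviolatedE; move: ava; rewrite /=; case: eqP => [->|_]; last first.
    exact: nonviolating_mono (ltW a_lt) (lexx _).
  (* On a self-loop the head is substituted as well: an odd priority forces [a = \top], against
     [a < nu v], and an even one never violates the arc. *)
  case: (boolP (odd (prio G v))) => [p_odd /(nonviolating_irrefl p_odd) aT|p_even _].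
    by move: a_lt; rewrite aT ltNge lex1.
  exact: nonviolating_refl.
have [_ /(_ a aS)] := tight_vy nv_vy.
by rewrite nonviolatedE /= eqxx => /(_ ava); rewrite leNgt a_lt.
Qed.

Section Closed.
Variables (h : nat) (T : {fset seq M}) (tau : V -> V) (mu : V -> label M).
Hypothesis tau_odd : odd_strategy G tau.

Let ok nu := [/\ forall v, in_Lbar T (nu v), forall v, mu v <= nu v
  & feasible G h (Gtau G tau) nu].

(** A relation instead of a labeling, so that a node may carry several candidate labels, each
    justified by an arc to a candidate of its head. *)
Definition closed_labels (R : V -> label M -> Prop) :=
  forall v a, R v a -> [/\ in_Lbar T a, mu v <= a &
    exists y b, [/\ arcs (Gtau G tau) v y, R y b
                  & nonviolating h (prio G v) a b]].

Lemma Gtau_out v : exists y, arcs (Gtau G tau) v y.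
Proof.
case: (boolP (v \in even_node G)) => vE.
  by have [y vy] := garc_total G v; exists y; rewrite /= vy vE.
by exists (tau v); rewrite /= tau_odd // eqxx orbT.
Qed.

(** The least candidate at a node is justified by an arc to some candidate of the head, and passing
    to the least one there only lowers the head. A node without candidates gets [\top], which
    violates no outgoing arc. *)
Lemma closed_labels_ok R : closed_labels R -> ok (fun v => tmin (R v)).
Proof.
move=> Rcl.
have Rmin v a : R v a -> R v (tmin (R v)) /\ forall b, R v b -> tmin (R v) <= b.
  by move=> Rva; apply: (@tmin_label_min _ _ T _ a) => // b /Rcl[].
pose nu v := tmin (R v).
have /choice[sigma sigmaP] : forall v, exists y,
    arcs (Gtau G tau) v y /\ nonviolated G h nu v y.
  move=> v; case: (pselect (nu v = \top)) => [vT|/tmin_attained Rv].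
    have [y vy] := Gtau_out v; exists y; split=> //.
    by rewrite nonviolatedE vT; apply: nonviolating_top.
  have [_ _ [y [b [vy Ryb nvb]]]] := Rcl _ _ Rv; exists y; split=> //.
  by rewrite nonviolatedE; apply: nonviolating_mono nvb => //; apply: (Rmin _ _ Ryb).2.
split=> [v|v|].
- by case: (pselect (tmin (R v) = \top)) => [->|/tmin_attained /Rcl[]] .
- by have [->|/tmin_attained /Rcl[]//] := pselect (tmin (R v) = \top); rewrite lex1.
- exists sigma; split=> [v _|v _ _|v y /= /andP[_ vy] vsigma].
  + by have [/andP[]] := sigmaP v.
  + by have [] := sigmaP v.
  have [/= /andP[_ v_sigma] nv] := sigmaP v.
  case: (boolP (v \in even_node G)) => vE; first by rewrite vsigma.
  by move: vy v_sigma nv; rewrite (negbTE vE) /= => /eqP -> /eqP ->.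
Qed.

(** With [closed_labels_ok], this makes the pointwise minimum of all admissible labelings
    admissible, so the least one exists. *)
Lemma ok_closed : closed_labels (fun v a => exists2 nu, ok nu & a = nu v).
Proof.
move=> v _ [nu nu_ok ->]; have [nuT munu [sigma [sE sarc snv]]] := nu_ok.
split=> //; case: (boolP (v \in even_node G)) => vE.
  have vs := sarc v vE (Gtau_out v).
  by exists (sigma v), (nu (sigma v)); split=> //; [exists nu | apply: snv].
have vs : arcs (Gtau G tau) v (tau v) by rewrite /= tau_odd // eqxx orbT.
by exists (tau v), (nu (tau v)); split=> //; [exists nu | apply: snv => //; rewrite (negbTE vE)].
Qed.

Lemma lift_closure_least nu v : ok nu -> lift_closure G h T tau mu v <= nu v.
Proof.
move=> nu_ok; rewrite /lift_closure -/ok; case: xgetP => [nu' _ [_]|]; first by apply.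
pose R v a := exists2 nu, ok nu & a = nu v.
case/(_ (fun v => tmin (R v))); split; first exact: closed_labels_ok ok_closed.
move=> nu' nu'_ok u; have Ru : R u (nu' u) by exists nu'.
have RT b : R u b -> in_Lbar T b by case/ok_closed.
exact: (tmin_label_min RT Ru).2.
Qed.

Lemma lift_closure_le R v a : closed_labels R -> R v a ->
  lift_closure G h T tau mu v <= a.
Proof.
move=> Rcl Rva; have RT b : R v b -> in_Lbar T b by case/Rcl.
apply: le_trans (lift_closure_least v (closed_labels_ok Rcl)) _.
exact: (tmin_label_min RT Rva).2.
Qed.

End Closed.
End Labelings.

(** * The graphs [J], the arcs of [D], and the greatest labeling [lam] *)

Section AuxiliaryDigraph.
Local Open Scope order_scope.
Context {V : finType} {d : nat} (G : parity_game V d) (tau : V -> V).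
Implicit Types (v w x y : V).

Notation J := (Jgraph G tau).

Lemma Jgraph_arc w x y :
  arcs (J w) x y -> [/\ x \in nodes (J w), y \in nodes (J w) & arcs (Gtau G tau) x y].
Proof.
rewrite /= !inE /=; case/and3P => /andP[/and3P[/and3P[-> -> ->]]].
by case/andP=> -> -> /andP[-> ->] _ -> ->.
Qed.

Lemma Jgraph_prio w x : x \in nodes (J w) -> (prio G x <= prio G w)%N.
Proof. by rewrite /= !inE /= => /andP[/andP[->]]. Qed.

Lemma Jgraph_root w : w \in nodes (J w).
Proof. by rewrite /= !inE /= leqnn !connect0. Qed.

Lemma hprio_Jgraph w : hprio G (J w) = prio G w.
Proof.
apply/eqP; rewrite eqn_leq /hprio leq_bigmax_cond ?Jgraph_root // andbT.
by apply/bigmax_leqP => x /Jgraph_prio.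
Qed.

Lemma Jgraph_out w x : x \in nodes (J w) -> x != w -> exists y, arcs (J w) x y.
Proof.
move=> xJ xw; have : connect (arcs (Kgraph' G tau w)) x w.
  by move: xJ; rewrite [nodes _]/= inE => /andP[_]; rewrite inE.
case/connectP => -[|y p] /=; first by move=> _ wx; rewrite wx eqxx in xw.
case/andP => xy yp wE; exists y; apply/and3P; split=> //; rewrite inE.
  by apply/connectP; exists (y :: p) => //=; rewrite yp andbT.
by apply/connectP; exists p.
Qed.

Lemma Dgraph_prio v w : arcs (Dgraph G tau) v w -> prio G v = prio G w.
Proof.
case/and3P => _ _; case: (eqVneq v w) => [-> //|_].
have dom_prio H : v \in dominators G H -> prio G v = hprio G H.
  by rewrite inE => /andP[_ /eqP].
by move/dom_prio => ->; apply: hprio_Jgraph.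
Qed.

Context {disp : Order.disp_t} {M : orderType disp}.
Implicit Types (S T : {fset seq M}) (nu mu : V -> label M).

Definition rooted_tight w S nu :=
  [/\ forall v, v \in nodes (J w) -> in_Lbar S (nu v), nu w = min_leaf S
    & forall v u, arcs (J w) v u -> ~ loose G (prio G w)./2 S nu v u].

(** A finite value is not the default of [xget], so it certifies that the greatest labeling
    exists. *)
Lemma lamP w S u : lam G tau S w u <> \top ->
  rooted_tight w S (lam G tau S w) /\
  forall nu, rooted_tight w S nu ->
    forall v, v \in nodes (J w) -> nu v <= lam G tau S w v.
Proof. by rewrite /lam; case: xgetP. Qed.

(* Otherwise the label of [x] could be increased up to the least label for
   which some arc out of [x] is non-violated. *)
Lemma greatest_rooted_tight_out w S lambda x :
  rooted_tight w S lambda ->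
  (forall nu, rooted_tight w S nu ->
    forall v, v \in nodes (J w) -> nu v <= lambda v) ->
  x \in nodes (J w) -> x != w ->
  exists2 y, arcs (J w) x y &
    nonviolating (prio G w)./2 (prio G x) (lambda x) (lambda y).
Proof.
set j := (prio G w)./2 => -[lamS lamw lamt] lam_max xJ xw.
pose P a := in_Lbar S a /\ exists2 y, arcs (J w) x y &
  nonviolating j (prio G x) a ([eta lambda with x |-> a] y).
have [y0 xy0] := Jgraph_out xJ xw.
have PT : P \top by split=> //; exists y0 => //; apply: nonviolating_top.
have PS a : P a -> in_Lbar S a by case.
have [[bS [y xy nvb]] bmin] := tmin_label_min PS PT.
set b := tmin P in bS nvb bmin.
have lamxb : lambda x <= b by exact: (not_looseP _ _ _ _ _ _).1 (lamt _ _ xy) _ bS nvb.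
pose nu := [eta lambda with x |-> b].
have nu_ge v : lambda v <= nu v by rewrite /nu /=; case: eqP => [->|].
have nu_ok : rooted_tight w S nu.
  split=> [v vJ|| v u vu].
  - by rewrite /nu /=; case: eqP => // _; apply: lamS.
  - by rewrite /nu /= eq_sym (negbTE xw).
  (* Raising [x] to [b] creates no loose arc: out of [x] by minimality of [b], elsewhere because a
     raised head only makes arcs harder to satisfy. *)
  apply/not_looseP => a aS; rewrite {1 2}/nu /=.
  move: vu; case: (eqVneq v x) => [->|vx] vu nva; rewrite -/j in nva *.
    apply: bmin; split=> //; exists u => //.
    by move: nva => /=; case: (u == x).
  apply: ((not_looseP _ _ _ _ _ _).1 (lamt _ _ vu) _ aS).
  apply: nonviolating_mono nva => //=; case: ifP => // _; exact: nu_ge.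
have blam : b = lambda x.
  by apply: le_anti; rewrite lamxb andbT; have := lam_max _ nu_ok _ xJ; rewrite /nu /= eqxx.
exists y => //; move: nvb; rewrite blam /=; case: eqP => [->|] //.
Qed.

End AuxiliaryDigraph.

(** Iterating [next] from any node of the cycle reaches [w], and [P] is pulled back along these
    iterates. *)
Lemma cycle_backward_ind (V : finType) (s : seq V) (P : V -> Prop) w :
  uniq s -> w \in s -> P w -> (forall x, x \in s -> P (next s x) -> P x) ->
  forall x, x \in s -> P x.
Proof.
move=> s_uniq ws Pw step x xs.
have xw : fconnect (next s) x w by rewrite (fconnect_cycle (cycle_next s_uniq)).
move: Pw; rewrite -(iter_findex xw).
elim: (findex _ _ _) => [//|n IH] Pn; apply: IH; apply: step => //.
by elim: n {Pn} => //= n; rewrite mem_next.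
Qed.

(** * Bounding the lift by a leaf [l], given a cycle of [D] *)

Section LiftClosureUpperBound.
Local Open Scope order_scope.
Context {V : finType} {d : nat} (G : parity_game V d) (tau : V -> V).
Context {disp : Order.disp_t} {M : orderType disp}.
Variables (h j : nat) (T : {fset seq M}) (mu : V -> label M) (l : seq M).
Hypotheses (tau_odd : odd_strategy G tau) (Totree : is_otree h T) (jh : (j <= h)%N).
Hypothesis mu_tight :
  forall v u, arcs (Gtau G tau) v u -> ~ loose G h T mu v u.
Hypothesis lT : l \in leaves T.
Notation r := (trunc h j.*2 l).
Hypothesis l_min : {in leaves T, forall l', trunc h j.*2 l' = r -> lexle l l'}.
Notation J := (Jgraph G tau).
Notation lbl := (tfin (l : seqlexi M)).

Definition leaf_map S (f : seq M -> seq M) :=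
  {in leaves S, forall y, f y \in leaves (subtree T r)} /\
  {in leaves S &, forall y z m,
    lexle (take m (f y)) (take m (f z)) = lexle (take m y) (take m z)}.

Let rsz : size r = (h - j)%N.
Proof. by rewrite (size_leaf_trunc _ Totree) // doubleK. Qed.

Lemma root_nonviolating l' : trunc h j.*2 l' = r ->
  nonviolating h j.*2 lbl (tfin (l' : seqlexi M)).
Proof.
by move=> l'r; rewrite nonviolating_tfin odd_double l'r /lexle lexx.
Qed.

(** A finite graft is a leaf below [r], and [l] is the least of these. *)
Lemma le_graft S f a : leaf_map S f -> in_Lbar S a -> lbl <= graft r f a.
Proof.
case=> fleaf fle aS; case: (eqVneq a \top) => [->|aT]; first by rewrite lex1.
by have [l' [-> l'T l'r]] := graft_root rsz jh fleaf aS aT; apply: l_min.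
Qed.

(* The least labeling of [J w] in [S] whose graft dominates [mu] has no loose
   arcs, hence is dominated by [lam]. *)
Lemma le_graft_lam S f w u : leaf_map S f -> prio G w = j.*2 -> mu w <= lbl ->
  lam G tau S w u <> \top ->
  forall x, x \in nodes (J w) -> mu x <= graft r f (lam G tau S w x).
Proof.
move=> fS wj mu_w /lamP [[lamS _ _] lam_max]; have [fleaf fle] := fS.
pose P x a := exists2 y, y \in leaves S &
  a = tfin (y : seqlexi M) /\ mu x <= graft r f a.
pose nu x := tmin (P x).
have PS x a : P x a -> in_Lbar S a by case=> y yS [-> _]; apply: in_Lbar_tfin.
have nuS x : in_Lbar S (nu x).
  by case: (pselect (nu x = \top)) => [->|/tmin_attained /PS].
have nu_ge x : mu x <= graft r f (nu x).
  by case: (pselect (nu x = \top)) => [->|/tmin_attained []]; [rewrite lex1 | move=> y _ []].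
have nu_min x a : in_Lbar S a -> mu x <= graft r f a -> nu x <= a.
  case: a => [y|] aS mu_x; last by rewrite lex1.
  have Pa : P x (tfin y) by exists y => //; apply: aS.
  exact: (tmin_label_min (@PS x) Pa).2.
have nu_ok : rooted_tight G tau w S nu.
  split=> // [|x y xy].
    (* At [w] every leaf of [S] qualifies, since [mu w <= lbl] and [lbl] is below every graft. *)
    congr tmin; apply: funext => a; apply: propext; split=> [[y yS [aE _]]|[y yS aE]].
      by exists y.
    exists y => //; split=> //; apply: le_trans mu_w (le_graft fS _).
    by rewrite aE; apply: in_Lbar_tfin.
  have [xJ _ xyG] := Jgraph_arc xy.
  have xp : (prio G x <= j.*2)%N by rewrite -wj (Jgraph_prio xJ).
  (* If [a] satisfies the arc in [S], its graft satisfies it in [T]; the arc is not loose for [mu],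
     so the graft dominates [mu x]. *)
  rewrite wj doubleK; apply/not_looseP => a aS nva; apply: nu_min => //.
  apply: ((not_looseP _ _ _ _ _ _).1 (mu_tight xyG) _ (graft_in_Lbar fleaf aS)).
  move: nva => /=; case: (y == x) => nva.
    exact (graft_nonviolating rsz jh fle xp aS aS nva).
  apply: nonviolating_mono (lexx _) (nu_ge y) _.
  exact (graft_nonviolating rsz jh fle xp aS (nuS y) nva).
move=> x xJ; apply: le_trans (nu_ge x) _.
exact (graft_le r fle (nuS x) (lamS _ xJ) (lam_max _ nu_ok _ xJ)).
Qed.

Section Cycle.
Variables (s : seq V) (w : V).
Hypotheses (s_uniq : uniq s) (ws : w \in s) (sj : forall t, t \in s -> prio G t = j.*2).
Hypothesis mu_w : mu w <= lbl.
Hypothesis s_step : forall v, v \in s -> exists S f u,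
  [/\ leaf_map S f, arcs (J (next s v)) v u & lam G tau S (next s v) u <> \top].

(** At priority [j.*2] only the prefix [r] is compared, so [lbl] at [v] satisfies the arc into [J]
    of the next node, where [mu] is bounded by a label below [r]. *)
Lemma mu_le_lbl t : t \in s -> mu t <= lbl.
Proof.
move: t; apply: (cycle_backward_ind s_uniq ws mu_w) => v vs mu_next.
have ts : next s v \in s by rewrite mem_next.
have [S [f [u [fS vu lamu]]]] := s_step vs; have [fleaf fle] := fS.
have [_ uJ vuG] := Jgraph_arc vu.
have [[lamS _ _] _] := lamP lamu.
apply: ((not_looseP _ _ _ _ _ _).1 (mu_tight vuG) _ (in_Lbar_tfin lT)).
rewrite sj //=; case: eqP => _; first by apply: root_nonviolating.
have := le_graft_lam fS (sj ts) mu_next lamu uJ.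
move/eqP in lamu; have [l' [-> _ l'r]] := graft_root rsz jh fleaf (lamS _ uJ) lamu.
by move=> mu_u; apply: nonviolating_mono (lexx _) mu_u _; apply: root_nonviolating.
Qed.

Lemma lift_closure_le_lbl : lift_closure G h T tau mu w <= lbl.
Proof.
pose Q v t S f u := [/\ v \in s, t = next s v, leaf_map S f, arcs (J t) v u
  & lam G tau S t u <> \top].
(* The graphs [J t] may overlap, so a node keeps a candidate from each of them; the root [t] is left
   out of its own graph because it carries [lbl]. *)
pose R x a := (x \in s /\ a = lbl) \/ exists v t S f u, Q v t S f u /\
  [/\ x \in nodes (J t), x != t & a = graft r f (lam G tau S t x)].
apply: (@lift_closure_le _ _ _ _ _ _ _ _ _ tau_odd R); last by left.
have Rhead v t S f u x : Q v t S f u -> x \in nodes (J t) -> exists2 b, R x b &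
    b <= graft r f (lam G tau S t x).
  move=> vtu xJ; have [vs tE fS vu lamu] := vtu.
  have [[lamS _ _] _] := lamP lamu.
  case: (eqVneq x t) => [xt|xt]; last first.
    by exists (graft r f (lam G tau S t x)) => //; right; exists v, t, S, f, u.
  exists lbl; last exact: le_graft fS (lamS _ xJ).
  by left; rewrite xt tE mem_next.
move=> x a [[xs ->]|[v [t [S [f [u [vtu [xJ xt ->]]]]]]]].
  split; [exact: in_Lbar_tfin | exact: mu_le_lbl |].
  have [S [f [u [fS xu lamu]]]] := s_step xs; have [fleaf _] := fS.
  have [_ uJ xuG] := Jgraph_arc xu.
  have [|b Rb b_le] := Rhead x (next s x) S f u u _ uJ; first by split.
  exists u, b; split=> //; rewrite sj //.
  apply: nonviolating_mono (lexx _) b_le _.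
  have [[lamS _ _] _] := lamP lamu; move/eqP in lamu.
  have [l' [-> _ l'r]] := graft_root rsz jh fleaf (lamS _ uJ) lamu.
  exact: root_nonviolating.
have [vs tE fS vu lamu] := vtu; have [fleaf fle] := fS.
have ts : t \in s by rewrite tE mem_next.
have [lam_ok lam_max] := lamP lamu; have [lamS _ _] := lam_ok.
split; first exact (graft_in_Lbar fleaf (lamS _ xJ)).
  exact: le_graft_lam fS (sj ts) (mu_le_lbl ts) lamu _ xJ.
(* Inside [J t] the justifying arc is one that [lam] does not violate; its head may be [t], where
   [Rhead] supplies [lbl]. *)
have [y xy nvxy] := greatest_rooted_tight_out lam_ok lam_max xJ xt.
have [_ yJ xyG] := Jgraph_arc xy.
have [b Rb b_le] := Rhead _ _ _ _ _ _ vtu yJ.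
exists y, b; split=> //; apply: nonviolating_mono (lexx _) b_le _.
have xp : (prio G x <= j.*2)%N by rewrite -(sj ts) (Jgraph_prio xJ).
rewrite sj // doubleK in nvxy.
exact (graft_nonviolating rsz jh fle xp (lamS _ xJ) (lamS _ yJ) nvxy).
Qed.

End Cycle.
End LiftClosureUpperBound.

Lemma simple_cycle_of_connect (V : finType) (e : rel V) w x :
  e w x -> connect e x w -> exists q, [/\ q != [::], ucycle e q & w \in q].
Proof.
move=> wx xw; move: xw wx => /connectP[p0 p0P ->].
case/shortenP: p0P => p pP p_uniq _ wx; exists (x :: p); split=> //.
  by rewrite /ucycle /= rcons_path pP wx.
by rewrite mem_last.
Qed.

Lemma bigmax_enat_le (V : eqType) (q : seq V) (F : V -> enat) (i : nat) :
  (\big[Order.max/tfin 0%N]_(v <- q) F v <= tfin i)%O = all (fun v => F v <= tfin i)%O q.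
Proof. by elim: q => [|v q IH]; rewrite ?big_nil // big_cons ge_max IH. Qed.

Lemma path_zip (V : eqType) (e : rel V) x p a b :
  path e x p -> (a, b) \in zip (x :: p) p -> e a b.
Proof.
elim: p x => //= y p IH x /andP[xy yp]; rewrite inE => /orP[/eqP[-> ->] //|].
exact: IH.
Qed.

(** * From a feasible cycle of [Gtau] to a cycle of [D] of cost at most [i] *)

Section CycleThroughBaseNodes.
Context {V : finType} {d : nat} (G : parity_game V d) (tau : V -> V).
Context {disp : Order.disp_t} {M : orderType disp}.
Variables (C : nat -> seq (seq {fset seq M})) (k j i : nat).
Variables (s : seq V) (w : V) (nu : V -> label M).
Notation chain := (nth [::] (C j) k).
Hypotheses (s_cycle : is_cycle (Gtau G tau) s) (ws : w \in s).
Hypothesis s_prio : forall v, v \in s -> prio G v <= prio G w.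
Hypothesis wj : prio G w = j.*2.
Hypothesis i_lt : i < size chain.
Hypothesis nu_leaf : forall v, v \in s ->
  exists2 l, l \in leaves (nth fset0 chain i) & nu v = tfin (l : seqlexi M).
Hypothesis nu_nv : forall v, v \in s ->
  nonviolating j (prio G v) (nu v) (nu (next s v)).

Notation J := (Jgraph G tau).
Notation arc := (arcs (cycle_graph s)).

Let s_uniq : uniq s. Proof. by case: s_cycle => _ /andP[]. Qed.

Lemma cycle_graph_cycle : cycle arc s.
Proof.
apply: (@sub_in_cycle _ [in s] (frel (next s))); last exact: cycle_next.
  by move=> x y /= xs _; rewrite eq_sym => yE; apply/andP; split.
by apply/allP.
Qed.

Lemma cycle_arc_Gtau x y : arc x y -> arcs (Gtau G tau) x y.
Proof.
by case/andP=> xs /eqP ->; case: s_cycle => _ /andP[/next_cycle -> //].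
Qed.

(** No node of the cycle has priority above that of [t], and the cycle connects each of its nodes
    with [t] in both directions. *)
Lemma cycle_connect_Kgraph t x y : prio G t = j.*2 -> t \in s ->
  arc x y -> arcs (Kgraph G tau t) x y.
Proof.
move=> tj ts xy; have /andP[xs yE] := xy.
have ys : y \in s by rewrite (eqP yE) mem_next.
have prio_le v : v \in s -> (prio G v <= prio G t)%N by move=> /s_prio; rewrite wj -tj.
have sub : subrel arc (arcs (below G (Gtau G tau) (prio G t))).
  move=> a b ab; have /andP[as_ bE] := ab.
  have bs : b \in s by rewrite (eqP bE) mem_next.
  by rewrite /= !inE !prio_le //; have /= -> := cycle_arc_Gtau ab.
have con a b : a \in s -> b \in s -> connect (arcs (below G (Gtau G tau) (prio G t))) a b.
  move=> as_ bs; have := connect_cycle cycle_graph_cycle as_ bs.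
  by apply: connect_sub => u v /sub; apply: connect1.
by apply/and3P; split; [exact: sub | |]; rewrite inE !con.
Qed.

Lemma cycle_base_node t : t \in s -> prio G t = j.*2 -> t \in base_nodes G tau.
Proof.
move=> ts tj; have hs : hprio G (cycle_graph s) = j.*2.
  apply/eqP; rewrite eqn_leq /hprio; apply/andP; split.
    by apply/bigmax_leqP => v; rewrite inE -wj => /s_prio.
  by rewrite -tj leq_bigmax_cond // inE.
rewrite inE; apply/asboolP; exists s; split=> //; first by rewrite hs odd_double.
by rewrite inE hs tj eqxx andbT inE.
Qed.

Lemma hprio_Kgraph t : hprio G (Kgraph G tau t) = prio G t.
Proof.
apply/eqP; rewrite eqn_leq /hprio; apply/andP; split.
  by apply/bigmax_leqP => v; rewrite !inE /= => /andP[].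
by rewrite leq_bigmax_cond // !inE /= leqnn !connect0.
Qed.

(* [Kgraph'] only removes the arcs into the dominators other than [t]. *)
Lemma segment_Jgraph t b p : t \in s -> prio G t = j.*2 ->
  path arc b p -> last b p = t ->
  (forall y, y \in p -> y != t -> prio G y != j.*2) ->
  path (arcs (J t)) b p.
Proof.
move=> ts tj bp bpt p_prio.
have K'p : path (arcs (Kgraph' G tau t)) b p.
  move: bp {bpt}; elim: p b p_prio => //= y p IH b p_prio /andP[xy yp].
  apply/andP; split; last by apply: IH => // z zp; apply: p_prio; rewrite inE zp orbT.
  have := cycle_connect_Kgraph tj ts xy => xyK.
  apply/andP; split; first exact: xyK.
  rewrite 3!inE negb_and negbK; case: (eqVneq y t) => //= yt.
  by rewrite negb_and hprio_Kgraph tj p_prio ?orbT // mem_head.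
move: bpt K'p {bp p_prio}; elim: p b => //= y p IH b ypt /andP[by_ yp].
rewrite -[X in X && _]/(arcs (J t) b y) IH // andbT.
apply/and3P; split=> //; rewrite inE; apply/connectP.
  by exists (y :: p) => //=; rewrite by_.
by exists p.
Qed.

(** The path from [c] to [t] lies in [J t], and [nu] labels it feasibly by leaves of the tree of
    index [i], so its width is at most [i]. *)
Lemma cost_upper_segment t b c p : t \in s -> prio G t = j.*2 ->
  path arc b (c :: p) -> last c p = t -> uniq (c :: p) ->
  (forall y, y \in c :: p -> y != t -> prio G y != j.*2) ->
  (cost_upper G C tau k b t <= tfin i)%O.
Proof.
move=> ts tj bcp cpt cp_uniq cp_prio.
have := segment_Jgraph ts tj bcp cpt cp_prio; rewrite /= => /andP[bcJ cpJ].
have [_ cJ _] := Jgraph_arc bcJ.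
have cp : path arc c p by case/andP: bcp.
have cps v : v \in c :: p -> v \in s.
  have cs : c \in s by case/andP: bcp => /andP[bs /eqP ->] _; rewrite mem_next.
  elim: p c cp cs {bcp cpt cp_uniq cp_prio bcJ cpJ cJ} => [|y p IH] c /=.
    by move=> _ cs; rewrite inE => /eqP ->.
  case/andP=> /andP[_ /eqP yE] yp cs; rewrite inE => /orP[/eqP -> //|].
  by apply: IH => //; rewrite yE mem_next.
(* The path contains [t], so [width] reads its chain at level [j]. *)
have hP : hprio G (path_graph c p) = j.*2.
  apply/eqP; rewrite eqn_leq /hprio; apply/andP; split.
    by apply/bigmax_leqP => v; rewrite inE -wj => /cps/s_prio.
  by rewrite -tj leq_bigmax_cond // inE -cpt mem_last.
pose P a := exists u p, [/\ arcs (J t) b u, is_path (J t) u p t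
  & a = width G C k (path_graph u p)].
have [_ /(_ (width G C k (path_graph c p)))] : P (tmin P) /\ forall x, P x -> (tmin P <= x)%O.
  by apply: (@tmin_enat_min P (width G C k (path_graph c p))); exists c, p.
move=> H; apply: le_trans (H _) _; first by exists c, p.
rewrite /width hP uphalf_double; set Q := (X in tmin X).
suff Qi : Q (tfin i) by have [_] := tmin_enat_min Qi; apply.
exists i; split=> //; exists nu; split; last first.
  by move=> v; rewrite inE => /cps/nu_leaf.
(* Even follows the cycle, and moves arbitrarily off it. *)
have /choice[sigma sigmaP] : forall v, exists y, garc G v y /\ (v \in s -> y = next s v).
  move=> v; case: (boolP (v \in s)) => vs; last by have [y vy] := garc_total G v; exists y.
  exists (next s v); split=> //.
  by have /andP[] : arcs (Gtau G tau) v (next s v) by apply: cycle_arc_Gtau; rewrite /= vs eqxx.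
have parc v y : arcs (path_graph c p) v y -> v \in s /\ y = next s v.
  by move=> /(path_zip cp)/andP[vs /eqP ->].
exists sigma; split=> [v _|v _ [y vy]|v y vy _].
- by have [] := sigmaP v.
- by have [vs yE] := parc _ _ vy; have [_ ->] := sigmaP v; rewrite // -yE.
- by have [vs ->] := parc _ _ vy; apply: nu_nv.
Qed.

Definition cheap_arc v t :=
  arcs (Dgraph G tau) v t && (cost_upper G C tau k v t <= tfin i)%O.

Lemma cheap_arc_segment t b c p : b \in s -> prio G b = j.*2 ->
  t \in s -> prio G t = j.*2 ->
  path arc b (c :: p) -> last c p = t -> uniq (c :: p) ->
  (forall y, y \in c :: p -> y != t -> prio G y != j.*2) ->
  cheap_arc b t.
Proof.
move=> bs bj ts tj bcp cpt cp_uniq cp_prio.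
apply/andP; split; last by apply: cost_upper_segment cpt _ _.
have := segment_Jgraph ts tj bcp cpt cp_prio; rewrite /= => /andP[bcJ _].
apply/and3P; split; [exact: cycle_base_node | exact: cycle_base_node |].
have [bJ _ _] := Jgraph_arc bcJ.
move: bcJ; case: (eqVneq b t) => [->|_] bcJ; first by apply/existsP; exists c.
by rewrite inE bJ hprio_Jgraph bj tj eqxx.
Qed.

(** The induction keeps the first dominator [t] on the path and the segment leading to it. When [b]
    is itself a dominator, it replaces [t], and the segment becomes one more cheap arc. *)
Lemma next_dominator b p : b \in s -> path arc b p -> last b p = w -> uniq (b :: p) ->
  exists t q, [/\ t \in s, prio G t = j.*2, {subset q <= p}, path arc b q
    & [/\ last b q = t, uniq (b :: q),
      (forall y, y \in b :: q -> y != t -> prio G y != j.*2)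
      & connect cheap_arc t w]].
Proof.
elim: p b => [|c p IH] b bs /=.
  move=> _ bw _; exists w, [::]; split=> //; split=> // y; rewrite inE bw => /eqP ->.
  by rewrite eqxx.
case/andP => bc cp cpw /andP[bcp cp_uniq].
have cs : c \in s by case/andP: bc => ? /eqP ->; rewrite mem_next.
have [t [q [ts tj qp cq [cqt cq_uniq q_prio tw]]]] := IH c cs cp cpw cp_uniq.
have bcq : path arc b (c :: q) by rewrite /= bc.
have sub : {subset c :: q <= c :: p}.
  by move=> y; rewrite !inE => /orP[->//|/qp ->]; rewrite orbT.
have [bj|bj] := eqVneq (prio G b) j.*2.
  exists b, [::]; split=> //; split=> //; first by move=> y; rewrite inE => ->.
  apply: connect_trans tw; apply: connect1.
  by apply: cheap_arc_segment bcq cqt _ _.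
exists t, (c :: q); split=> //; split=> //.
  by apply/andP; split; [apply: contra bcp; apply: sub | exact: cq_uniq].
by move=> y; rewrite inE => /orP[/eqP -> //|]; apply: q_prio.
Qed.

Lemma cheap_cycle : exists q, [/\ is_cycle (Dcomp G tau w) q, w \in q
  & forall v, v \in q -> (cost_upper G C tau k v (next q v) <= tfin i)%O].
Proof.
have [n s' sE] := rot_to ws.
have s'_uniq : uniq (w :: s') by rewrite -sE rot_uniq.
have s'c : path arc w (rcons s' w).
  by have := cycle_graph_cycle; rewrite -(rot_cycle n) sE.
(* Moving [w] from the front to the end gives the repetition-free path ending at [w] that
   [next_dominator] expects. *)
case pE : (rcons s' w) => [|b p]; first by case: (s') pE.
have bp_uniq : uniq (b :: p) by rewrite -pE rcons_uniq -cons_uniq.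
move: (s'c); rewrite pE /= => /andP[wb bp].
have bs : b \in s by case/andP: wb => _ /eqP ->; rewrite mem_next.
have bpw : last b p = w by rewrite -(last_rcons w s' w) pE.
have [t [q [ts tj _ bq [bqt bq_uniq q_prio tw]]]] := next_dominator bs bp bpw bp_uniq.
have wt : cheap_arc w t by apply: cheap_arc_segment bqt _ _ => //=; rewrite wb.
have [r [r0 /andP[r_cycle r_uniq] wr]] := simple_cycle_of_connect wt tw.
have rD : cycle (arcs (Dgraph G tau)) r.
  by apply: sub_cycle r_cycle => x y /andP[].
exists r; split=> //; last by move=> v vr; have /andP[] := next_cycle r_cycle vr.
split=> //; rewrite /ucycle r_uniq andbT.
apply: (@sub_in_cycle _ [in r] _ _ _ _ _ rD); last by apply/allP.
move=> x y xr yr xy; apply/and3P; split=> //; rewrite inE; apply/andP; split;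
  exact: (connect_cycle rD).
Qed.

End CycleThroughBaseNodes.

(** * The two inequalities *)

Section Bounds.
Local Open Scope order_scope.
Context {V : finType} {d : nat} (G : parity_game V d) (tau : V -> V).
Context {disp : Order.disp_t} {M : orderType disp}.
Variables (h : nat) (T : {fset seq M}) (reps : nat -> {fset {fset seq M}}).
Variables (C : nat -> seq (seq {fset seq M})) (mu : V -> label M) (w : V).
Notation j := (prio G w)./2.
Hypotheses (tau_odd : odd_strategy G tau) (Totree : is_otree h T).
Hypotheses (Treps : is_reps h T reps) (Ccover : is_cover h reps C).
Hypothesis mu_tight :
  forall v u, arcs (Gtau G tau) v u -> ~ loose G h T mu v u.
Hypotheses (w_even : ~~ odd (prio G w)) (jh : (j <= h)%N).

Let wj : prio G w = j.*2. Proof. by rewrite even_halfK. Qed.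

Lemma subtree_rank_otree r : r \in T -> size r = (h - j)%N -> is_otree j (subtree T r).
Proof. by move=> rT rsz; have := subtree_otree Totree rT; rewrite rsz subKn. Qed.

Lemma rep_otree S : S \in reps j -> is_otree j S.
Proof.
have [reps_sub _ _] := Treps jh.
by move=> /reps_sub[r [rT rsz ->]]; apply: subtree_rank_otree.
Qed.

Section LowerCosts.
Variables (k : nat) (c : V -> V -> enat).
Notation chain := (nth [::] (C j) k).
Hypothesis k_lt : (k < size (C j))%N.
Hypothesis lower_c : forall v u, arcs (Dcomp G tau w) v u ->
  cost_lower G C tau k v u <= c v u.

Lemma chain_embeds i i' : (i <= i')%N -> (i' < size chain)%N ->
  embeds (nth fset0 chain i) (nth fset0 chain i').
Proof.
have [_ chain_lt _] := Ccover jh.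
rewrite leq_eqVlt => /orP[/eqP -> _|ii' i'_lt]; first exact: embeds_refl.
by have [] := chain_lt _ _ _ (mem_nth [::] k_lt) ii' i'_lt.
Qed.

Lemma lift_closure_le_raised :
  lift_closure G h T tau mu w <= raised_label G h T C tau mu w k c.
Proof.
rewrite /raised_label; case iE: min_cycle_cost => [i|]; last exact: lex1.
have [q [qD wq q_cost]] : exists q, [/\ is_cycle (Dcomp G tau w) q, w \in q
    & tfin i = cycle_cost c q].
  exact: tmin_tfin iE.
have [_ /andP[q_cycle q_uniq]] := qD.
case xE: raise => [x|]; last exact: lex1.
have [l [[->] lT mu_l l_min [i' [ii' i'_lt [_ eqv]]]]] := tmin_tfin xE.
have q_arc v : v \in q -> arcs (Dcomp G tau w) v (next q v) by exact: next_cycle.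
have q_prio t : t \in q -> prio G t = j.*2.
  move: t; apply: (cycle_backward_ind q_uniq wq wj) => v vq <-.
  by have /and3P[/Dgraph_prio ->] := q_arc v vq.
apply: (lift_closure_le_lbl tau_odd Totree jh mu_tight lT l_min q_uniq wq q_prio mu_l).
move=> v vq; have tq : next q v \in q by rewrite mem_next.
have cv : c v (next q v) <= tfin i.
  have : cycle_cost c q <= tfin i by rewrite -q_cost.
  by rewrite bigmax_enat_le => /allP /(_ v vq).
have /le_tfin[i0 i0E i0i] := le_trans (lower_c (q_arc v vq)) cv.
have [i1 [i1_lt i1E [u vu lamu]]] : exists i1,
    [/\ (i1 < size chain)%N, tfin i0 = tfin i1 &
    exists2 u, arcs (Jgraph G tau (next q v)) v u &
      lam G tau (nth fset0 chain i1) (next q v) u <> \top].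
  by have := tmin_tfin i0E; rewrite q_prio // doubleK.
case: i1E i1_lt lamu => <- i0_lt lamu.
have [chain_reps _ _] := Ccover jh.
have SR : nth fset0 chain i0 \in reps j.
  by apply: chain_reps (mem_nth _ k_lt) _; apply: mem_nth.
(* The chain increases and [i0 <= i <= i'], where the tree of index [i'] is equivalent to the
   subtree selected by [raise]. *)
have emb : embeds (nth fset0 chain i0) (subtree T (trunc h j.*2 l)).
  by apply: embeds_trans eqv; apply: chain_embeds => //; apply: leq_trans ii'.
have rootT : is_otree j (subtree T (trunc h j.*2 l)).
  apply: subtree_rank_otree; first exact: leaf_trunc_mem Totree lT.
  by rewrite (size_leaf_trunc _ Totree) // doubleK.
have [f fmap] := embeds_leaves (rep_otree SR) rootT emb.
by exists (nth fset0 chain i0), f, u.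
Qed.

End LowerCosts.

Section UpperCosts.
Variables (s : seq V) (nu : V -> label M).
Hypotheses (s_cycle : is_cycle (Gtau G tau) s).
Hypothesis w_dom : w \in dominators G (cycle_graph s).
Hypotheses (nuT : forall v, in_Lbar T (nu v)) (mu_nu : mu w <= nu w).
Hypothesis nu_feasible : feasible G h (cycle_graph s) nu.

Let s_uniq : uniq s. Proof. by case: s_cycle => _ /andP[]. Qed.

Let ws : w \in s. Proof. by move: w_dom; rewrite !inE => /andP[]. Qed.

Let s_prio v : v \in s -> (prio G v <= prio G w)%N.
Proof.
move=> vs; move: w_dom; rewrite inE => /andP[_ /eqP ->].
by apply: leq_bigmax_cond; rewrite inE.
Qed.

Let s_nv v : v \in s -> nonviolating h (prio G v) (nu v) (nu (next s v)).
Proof.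
move=> vs; have [sigma [_ s_sigma nv]] := nu_feasible.
have v_next : arcs (cycle_graph s) v (next s v) by rewrite /= vs eqxx.
apply: nv => // vE; apply/esym/eqP.
by have /andP[] := s_sigma v vE (ex_intro (arcs _ v) _ v_next).
Qed.

Let s_arc v : v \in s -> arcs (Gtau G tau) v (next s v).
Proof. by move=> vs; have [_ /andP[/next_cycle -> //]] := s_cycle. Qed.

Lemma mu_le_on_cycle v : v \in s -> mu v <= nu v.
Proof.
move: v; apply: (cycle_backward_ind s_uniq ws mu_nu) => v vs mu_next.
apply: ((not_looseP _ _ _ _ _ _).1 (mu_tight (s_arc vs)) _ (@nuT v)).
have := s_nv vs; rewrite /=; case: eqP => [->|_] //.
exact: nonviolating_mono.
Qed.

(** At the even priority [j.*2] the truncated labels never increase along an arc, which around a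
    cycle forces equality. *)
Lemma ltrunc_on_cycle v : v \in s -> ltrunc h j.*2 (nu v) = ltrunc h j.*2 (nu w).
Proof.
have le_on_cycle u : u \in s ->
    forall x, x \in s -> ltrunc h j.*2 (nu u) <= ltrunc h j.*2 (nu x).
  move=> us; apply: (cycle_backward_ind s_uniq us (lexx _)) => x xs.
  move/le_trans; apply.
  have : nonviolating h j.*2 (nu x) (nu (next s x)).
    by apply: nonviolating_trunc_le (s_nv xs); rewrite ?odd_double // -wj s_prio.
  by rewrite /nonviolating odd_double.
by move=> vs; apply: le_anti; rewrite !le_on_cycle.
Qed.

Lemma raised_le_on_cycle (c : nat -> V -> V -> enat) :
  nu w <> \top ->
  (forall k, (k < size (C j))%N -> forall v u, arcs (Dcomp G tau w) v u ->
    c k v u <= cost_upper G C tau k v u) ->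
  exists2 k, (k < size (C j))%N & raised_label G h T C tau mu w k (c k) <= nu w.
Proof.
case nuw: (nu w) => [x|] // _ c_upper.
have xT : x \in leaves T by apply: nuT nuw.
set r := trunc h j.*2 x.
have rT : r \in T := leaf_trunc_mem _ Totree xT.
have rsz : size r = (h - j)%N by rewrite (size_leaf_trunc _ Totree) // doubleK.
have nu_root v : v \in s -> exists y, [/\ nu v = tfin (r ++ y : seqlexi M),
    r ++ y \in leaves T & y \in leaves (subtree T r)].
  move=> vs; have := ltrunc_on_cycle vs; rewrite nuw /=.
  case nuv: (nu v) => [z|] // -[zr]; exists (drop (h - j) z).
  have zE : r ++ drop (h - j) z = z by rewrite /r -zr -trunc_drop.
  by rewrite leaves_subtree zE; split=> //; apply: nuT nuv.
pose P a := exists2 l : seq M, a = tfin (l : seqlexi M) & l \in leaves T /\ trunc h j.*2 l = r.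
have Px : P (tfin x) by exists x.
have PT a : P a -> in_Lbar T a by case=> y -> [yT _]; apply: in_Lbar_tfin.
have [[l lE [lT lr]] l_min] := tmin_label_min PT Px.
have lx := l_min _ Px; rewrite lE in l_min lx.
(* [l] agrees up to [r] with the label of the next node, so giving it to [w] satisfies the arc; not
   being loose, that arc bounds [mu w]. *)
have mu_l : mu w <= tfin (l : seqlexi M).
  apply: ((not_looseP _ _ _ _ _ _).1 (mu_tight (s_arc ws)) _ (in_Lbar_tfin lT)).
  rewrite wj /=; case: eqP => [_|_]; first by apply: nonviolating_refl; rewrite odd_double.
  have ns : next s w \in s by rewrite mem_next.
  apply: nonviolating_mono (lexx _) (mu_le_on_cycle ns) _.
  by rewrite /nonviolating odd_double ltrunc_on_cycle // nuw /= lr.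
have [_ _ reps_ex] := Treps jh; have [_ _ cover_ex] := Ccover jh.
have [S SR eqvS] := reps_ex r rT rsz; have [ch chC Sch] := cover_ex S SR.
(* The position in the cover of the representative of the subtree at [r]. *)
pose k := index ch (C j); pose i := index S ch.
have k_lt : (k < size (C j))%N by rewrite index_mem.
have chE : nth [::] (C j) k = ch by rewrite nth_index.
have i_lt : (i < size ch)%N by rewrite index_mem.
have SE : nth fset0 ch i = S by rewrite nth_index.
have [f [fleaf fle]] := embeds_leaves (subtree_rank_otree rT rsz) (rep_otree SR) eqvS.1.
(* All labels on the cycle lie below [r]; removing [r] and applying [f] moves them into [S], at
   height [j]. *)
pose nu' v : label M := if nu v is Some z then tfin (f (drop (h - j) z) : seqlexi M) else \top.
have nu'E v y : nu v = tfin (r ++ y : seqlexi M) -> nu' v = tfin (f y : seqlexi M).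
  by move=> nuv; rewrite /nu' nuv /= -rsz drop_size_cat.
exists k => //.
have [q [qD wq q_cost]] : exists q, [/\ is_cycle (Dcomp G tau w) q, w \in q
    & forall v, v \in q -> cost_upper G C tau k v (next q v) <= tfin i].
  apply: (@cheap_cycle _ _ G tau _ _ C k j i s w nu') => //.
  - by rewrite chE.
  - move=> v /nu_root[y [/nu'E -> _ yS]]; exists (f y) => //.
    by rewrite chE SE; apply: fleaf.
  - move=> v vs; have ns : next s v \in s by rewrite mem_next.
    have [y [nuv _ yS]] := nu_root _ vs; have [z [nun _ zS]] := nu_root _ ns.
    have vj : (prio G v <= j.*2)%N by rewrite -wj s_prio.
    have := s_nv vs; rewrite nuv nun (nu'E _ _ nuv) (nu'E _ _ nun).
    by rewrite !nonviolating_tfin !(@trunc_cat _ _ h j) // !lexle_cat !fle.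
have [_ /andP[q_cycle _]] := qD.
have c_cost : cycle_cost (c k) q <= tfin i.
  rewrite bigmax_enat_le; apply/allP => v vq; apply: le_trans (q_cost _ vq).
  by apply: c_upper => //; apply: next_cycle.
have [_ min_le] := @tmin_enat_min (fun a => exists s, [/\ is_cycle (Dcomp G tau w) s,
  w \in s & a = cycle_cost (c k) s]) _ (ex_intro _ q (And3 qD wq erefl)).
(* [raise] accepts every index from the minimum cost [i'] on, hence accepts [l] with index [i]. *)
have /le_tfin[i' i'E i'i] : min_cycle_cost (c k) (Dcomp G tau w) w <= tfin i.
  by apply: le_trans c_cost; apply: min_le; exists q.
rewrite /raised_label i'E; apply: le_trans lx.
rewrite /raise chE; set Q := (X in tmin X).
have QT a : Q a -> in_Lbar T a by case=> y [-> yT _ _ _]; apply: in_Lbar_tfin.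
suff Ql : Q (tfin (l : seqlexi M)) by have [_] := tmin_label_min QT Ql; apply.
exists l; split=> //; last by exists i; split=> //; rewrite lr SE.
by move=> l' l'T; rewrite lr => l'r; apply: (l_min (tfin (l' : seqlexi M))); exists l'.
Qed.

End UpperCosts.
End Bounds.

Theorem theorem4p11 (V : finType) (d : nat) (G : parity_game V d)
    (tau : V -> V) (disp : Order.disp_t) (M : orderType disp)
    (T : {fset seq M}) (reps : nat -> {fset {fset seq M}})
    (C : nat -> seq (seq {fset seq M})) (mu : V -> label M) (w : V)
    (c : nat -> V -> V -> enat) :
  odd_strategy G tau ->
  universal #|V| d./2 T ->
  is_reps d./2 T reps ->
  is_cover d./2 reps C ->
  (forall v, in_Lbar T (mu v)) ->
  (forall v u, arcs (Gtau G tau) v u -> ~ loose G d./2 T mu v u) ->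
  w \in base_nodes G tau ->
  (forall k, k < size (C (prio G w)./2) ->
     forall v u, arcs (Dcomp G tau w) v u ->
       (cost_lower G C tau k v u <= c k v u)%O /\
       (c k v u <= cost_upper G C tau k v u)%O) ->
  let xi k := raised_label G d./2 T C tau mu w k (c k) in
  let m := \big[Order.min / \top%O]_(k < size (C (prio G w)./2)) xi k in
  (lift_closure G d./2 T tau mu w <= m)%O /\
  (m <= threshold G d./2 T tau mu w)%O.
Proof.
move=> tau_odd [Totree _] Treps Ccover _ mu_tight w_base c_bounds xi m.
(* A base node has the priority of an even cycle that it dominates. *)
have w_even : ~~ odd (prio G w).
  move: w_base; rewrite inE => /asboolP[s [_ s_even]].
  by rewrite inE => /andP[_ /eqP ->].
have jh : (prio G w)./2 <= d./2 by have /andP[_ wd] := prio_bound G w; exact: half_leq.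
split.
  apply/bigmin_geP; split=> [|k _]; first exact: lex1.
  apply: (lift_closure_le_raised tau_odd Totree Treps Ccover) => // v u vu.
  by have [] := c_bounds k (ltn_ord k) v u vu.
case xE: (threshold G d./2 T tau mu w) => [x|]; last exact: lex1.
have [nu [s [nuT mu_nu s_cycle w_dom [nu_feas nuE]]]] := tmin_tfin xE.
rewrite -/(tfin x) {}nuE; case: (pselect (nu w = \top%O)) => [->|nuw]; first exact: lex1.
have [|k k_lt xi_le] := raised_le_on_cycle Totree Treps Ccover mu_tight w_even jh
  s_cycle w_dom nuT mu_nu nu_feas nuw (c := c).
  by move=> k k_lt v u vu; have [] := c_bounds k k_lt v u vu.
exact: le_trans (bigmin_le _ (Ordinal k_lt) _) xi_le.
Qed.
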